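(* Let $m_1,m_2,\kappa_1,\kappa_2,\kappa>0$, $b\geq0$, $\alpha_1,\alpha_2\in\mathbb{R}$, and let $p$ be real with $|p|\leq 1/5$. Consider the Lagrangian $$L=\sum_{j=1}^{2}\left[\frac{m_{j}}{2}\dot{x}_{j}^{2}-\frac{(\kappa_{j}-b\kappa)+p\alpha_{j}\kappa_{j}}{2}x_{j}^{2}\right]-\frac{b\kappa}{2}(x_{1}-x_{2})^{2}$$ for two real functions $x_1(t),x_2(t)$, and put $$\widetilde{\Omega}_{j}^{2}(p)=\frac{(1+p\alpha_{j})\kappa_{j}}{m_{j}},\quad j=1,2.$$ Then the Euler-Lagrange equations of $L$ have a nontrivial solution of the form $x_j=c_je^{\mathrm{i}\omega t}$, $j=1,2$, if and only if $$\left(\omega^{2}-\widetilde{\Omega}_{1}^{2}(p)\right)\left(\omega^{2}-\widetilde{\Omega}_{2}^{2}(p)\right)=\frac{b^{2}\kappa^{2}}{m_{1}m_{2}},$$ equivalently, if and only if $\omega^2$ is one of $$\omega_{\pm}^{2}(p,b)=\frac{\widetilde{\Omega}_{1}^{2}+\widetilde{\Omega}_{2}^{2}}{2}\pm\sqrt{\frac{\left(\widetilde{\Omega}_{1}^{2}-\widetilde{\Omega}_{2}^{2}\right)^{2}}{4}+\frac{b^{2}\kappa^{2}}{m_{1}m_{2}}}.$$ Moreover, if $\alpha_1\kappa_1/m_1\neq\alpha_2\kappa_2/m_2$, the condition $\widetilde{\Omega}_{1}^{2}(p^{*})=\widetilde{\Omega}_{2}^{2}(p^{*})$ has, independently of $b$,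 the solution $$p^{*}=\frac{\kappa_{2}/m_{2}-\kappa_{1}/m_{1}}{\alpha_{1}\kappa_{1}/m_{1}-\alpha_{2}\kappa_{2}/m_{2}},$$ and if $|p^*|\leq1/5$ then, with $\Omega^{*2}=\widetilde{\Omega}_{1}^{2}(p^{*})=\widetilde{\Omega}_{2}^{2}(p^{*})$, $$\omega_{\pm}^{2}(p^{*},b)=\Omega^{*2}\pm\frac{b\kappa}{\sqrt{m_{1}m_{2}}},$$ so that $\omega_\pm^2(p^*,b)\neq\Omega^{*2}$ for $b>0$.
   Context: The $x_j$ are displacements of two harmonic oscillators with masses $m_j$, bare spring constants $\kappa_j$, coupling spring constant $\kappa$, and dimensionless coupling amplitude $b$. $\widetilde\Omega_j^2(p)$ is the notation for the squared partial frequency (a real number). ''Nontrivial'' means $(c_1,c_2)\neq(0,0)$, with $c_1,c_2\in\mathbb{C}$. *)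

(* Defs.v *)
From Stdlib Require Import Reals.
From Coquelicot Require Import Coquelicot.

Open Scope R_scope.

(** [euler_lagrange L x1 x2]: the pair of real functions [x1], [x2] satisfies,
    at every time, d/dt (dL/dv_j) = dL/dx_j for j = 1, 2, where
    [L x1 x2 v1 v2] is a Lagrangian in positions and velocities.  [Derive] is
    total, so the existence of the velocities is required separately; the
    partial derivatives of [L] are meaningful for a differentiable [L] only. *)
Definition euler_lagrange (L : R -> R -> R -> R -> R) (x1 x2 : R -> R) : Prop :=
  (forall t, ex_derive x1 t /\ ex_derive x2 t) /\
  (forall t,
     is_derive
       (fun s => Derive (fun v => L (x1 s) (x2 s) v (Derive x2 s)) (Derive x1 s))
       t
       (Derive (fun x => L x (x2 t) (Derive x1 t) (Derive x2 t)) (x1 t))) /\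
  (forall t,
     is_derive
       (fun s => Derive (fun v => L (x1 s) (x2 s) (Derive x1 s) v) (Derive x2 s))
       t
       (Derive (fun x => L (x1 t) x (Derive x1 t) (Derive x2 t)) (x2 t))).

(** Complex-valued solutions, for a real quadratic [L]: its Euler-Lagrange
    equations are linear homogeneous with real coefficients, so that a complex
    function solves them exactly when its real and imaginary parts do. *)
Definition euler_lagrange_C (L : R -> R -> R -> R -> R) (x1 x2 : R -> C) : Prop :=
  euler_lagrange L (fun t => Re (x1 t)) (fun t => Re (x2 t)) /\
  euler_lagrange L (fun t => Im (x1 t)) (fun t => Im (x2 t)).

Definition Cexp (z : C) : C :=
  (exp (Re z) * cos (Im z), exp (Re z) * sin (Im z)).

(** The j-th summand of the Lagrangian, with [m], [k], [alpha] standing for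
    m_j, kappa_j, alpha_j. *)
Definition oscillator_term (m k kappa b alpha p x v : R) : R :=
  m / 2 * v ^ 2 - ((k - b * kappa) + p * alpha * k) / 2 * x ^ 2.

Definition lagrangian (m1 m2 k1 k2 kappa b alpha1 alpha2 p : R)
    (x1 x2 v1 v2 : R) : R :=
  oscillator_term m1 k1 kappa b alpha1 p x1 v1
  + oscillator_term m2 k2 kappa b alpha2 p x2 v2
  - b * kappa / 2 * (x1 - x2) ^ 2.

(** The "squares" below are real numbers of either sign, not squares of reals. *)
Definition Omega_sq (m k alpha p : R) : R := (1 + p * alpha) * k / m.

Definition omega_plus_sq (m1 m2 k1 k2 kappa alpha1 alpha2 p b : R) : R :=
  (Omega_sq m1 k1 alpha1 p + Omega_sq m2 k2 alpha2 p) / 2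
  + sqrt ((Omega_sq m1 k1 alpha1 p - Omega_sq m2 k2 alpha2 p) ^ 2 / 4
          + b ^ 2 * kappa ^ 2 / (m1 * m2)).

Definition omega_minus_sq (m1 m2 k1 k2 kappa alpha1 alpha2 p b : R) : R :=
  (Omega_sq m1 k1 alpha1 p + Omega_sq m2 k2 alpha2 p) / 2
  - sqrt ((Omega_sq m1 k1 alpha1 p - Omega_sq m2 k2 alpha2 p) ^ 2 / 4
          + b ^ 2 * kappa ^ 2 / (m1 * m2)).

Definition p_star (m1 m2 k1 k2 alpha1 alpha2 : R) : R :=
  (k2 / m2 - k1 / m1) / (alpha1 * k1 / m1 - alpha2 * k2 / m2).

(** [omega] is complex since omega^2 may be a negative real number. *)
Definition has_eigenmode (L : R -> R -> R -> R -> R) (omega : C) : Prop :=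
  exists c1 c2 : C,
    (c1, c2) <> (RtoC 0, RtoC 0) /\
    euler_lagrange_C L
      (fun t : R => (c1 * Cexp (Ci * omega * RtoC t))%C)
      (fun t : R => (c2 * Cexp (Ci * omega * RtoC t))%C).

(* Main.v *)
Require Import Defs.
From Stdlib Require Import Reals Lra.
From Coquelicot Require Import Coquelicot.

Open Scope R_scope.

(** Inserting the exponential ansatz turns the Euler-Lagrange equations into a
    homogeneous 2x2 linear system for the amplitudes, since [exp (i omega t)]
    is 1 at [t = 0] and can be factored out at every other time; a nontrivial
    pair of amplitudes exists exactly when the determinant vanishes, which is a
    quadratic equation in [omega ^ 2] with real roots. *)

(** * Equations of motion of the coupled oscillators *)

(** The term [- b * kappa] in the spring constants cancels the diagonal part of the coupling energy,
    so only the stiffness [(1 + p * alpha) * k] and the cross force [b * kappa] remain. Velocities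
    and accelerations are passed as explicit functions, which removes [Derive] from the result. *)
Lemma euler_lagrange_newton (m1 m2 k1 k2 kappa b alpha1 alpha2 p : R)
    (x1 x2 v1 v2 a1 a2 : R -> R) :
  (forall t, is_derive x1 t (v1 t)) -> (forall t, is_derive x2 t (v2 t)) ->
  (forall t, is_derive v1 t (a1 t)) -> (forall t, is_derive v2 t (a2 t)) ->
  euler_lagrange (lagrangian m1 m2 k1 k2 kappa b alpha1 alpha2 p) x1 x2 <->
  (forall t, m1 * a1 t = b * kappa * x2 t - (1 + p * alpha1) * k1 * x1 t /\
             m2 * a2 t = b * kappa * x1 t - (1 + p * alpha2) * k2 * x2 t).
Proof.
intros Hx1 Hx2 Hv1 Hv2.
assert (momentum1 : forall y1 y2 w1 w2,
  Derive (fun v => lagrangian m1 m2 k1 k2 kappa b alpha1 alpha2 p y1 y2 v w2) w1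
  = m1 * w1).
{ intros; apply is_derive_unique; unfold lagrangian, oscillator_term.
  auto_derive; [easy | field]. }
assert (momentum2 : forall y1 y2 w1 w2,
  Derive (fun v => lagrangian m1 m2 k1 k2 kappa b alpha1 alpha2 p y1 y2 w1 v) w2
  = m2 * w2).
{ intros; apply is_derive_unique; unfold lagrangian, oscillator_term.
  auto_derive; [easy | field]. }
assert (force1 : forall y1 y2 w1 w2,
  Derive (fun x => lagrangian m1 m2 k1 k2 kappa b alpha1 alpha2 p x y2 w1 w2) y1
  = b * kappa * y2 - (1 + p * alpha1) * k1 * y1).
{ intros; apply is_derive_unique; unfold lagrangian, oscillator_term.
  auto_derive; [easy | field]. }
assert (force2 : forall y1 y2 w1 w2,
  Derive (fun x => lagrangian m1 m2 k1 k2 kappa b alpha1 alpha2 p y1 x w1 w2) y2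
  = b * kappa * y1 - (1 + p * alpha2) * k2 * y2).
{ intros; apply is_derive_unique; unfold lagrangian, oscillator_term.
  auto_derive; [easy | field]. }
(* [Derive x1] agrees with [v1] at all times, so the momentum can be differentiated through [v1]. *)
assert (rate1 : forall t, is_derive (fun s => m1 * Derive x1 s) t (m1 * a1 t)).
{ intro t; apply (is_derive_ext (fun s => m1 * v1 s)).
  - intro s; now rewrite (is_derive_unique _ _ _ (Hx1 s)).
  - now apply is_derive_scal. }
assert (rate2 : forall t, is_derive (fun s => m2 * Derive x2 s) t (m2 * a2 t)).
{ intro t; apply (is_derive_ext (fun s => m2 * v2 s)).
  - intro s; now rewrite (is_derive_unique _ _ _ (Hx2 s)).
  - now apply is_derive_scal. }
split.
- intros [_ [E1 E2]] t; split.
  + rewrite <- (is_derive_unique _ _ _ (rate1 t)), <- (force1 _ _ (Derive x1 t) (Derive x2 t)).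
    apply is_derive_unique.
    eapply is_derive_ext; [intro s; apply momentum1 | apply E1].
  + rewrite <- (is_derive_unique _ _ _ (rate2 t)), <- (force2 _ _ (Derive x1 t) (Derive x2 t)).
    apply is_derive_unique.
    eapply is_derive_ext; [intro s; apply momentum2 | apply E2].
- intros E; split; [| split].
  + intro t; split; [now exists (v1 t) | now exists (v2 t)].
  + intro t; rewrite force1, <- (proj1 (E t)).
    eapply is_derive_ext; [intro s; symmetry; apply momentum1 | apply rate1].
  + intro t; rewrite force2, <- (proj2 (E t)).
    eapply is_derive_ext; [intro s; symmetry; apply momentum2 | apply rate2].
Qed.

(** * The exponential ansatz *)

(** The derivative has the same shape with [c] replaced by [c * z], so a second use, at amplitude
    [c * z], yields the acceleration. *)
Lemma is_derive_Re_Cexp (c z : C) (t : R) :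
  is_derive (fun s : R => Re (c * Cexp (z * RtoC s))%C) t
    (Re (c * z * Cexp (z * RtoC t))%C).
Proof.
destruct c as [c d], z as [u w]; unfold Cexp, Re, Im; simpl.
auto_derive; [easy | unfold Rminus; ring].
Qed.

Lemma is_derive_Im_Cexp (c z : C) (t : R) :
  is_derive (fun s : R => Im (c * Cexp (z * RtoC s))%C) t
    (Im (c * z * Cexp (z * RtoC t))%C).
Proof.
destruct c as [c d], z as [u w]; unfold Cexp, Re, Im; simpl.
auto_derive; [easy | unfold Rminus; ring].
Qed.

Lemma Cexp_0 : Cexp (RtoC 0) = RtoC 1.
Proof.
unfold Cexp, RtoC, Re, Im; simpl.
now rewrite exp_0, cos_0, sin_0, Rmult_1_l, Rmult_0_r.
Qed.

Lemma euler_lagrange_C_Cexp (m1 m2 k1 k2 kappa b alpha1 alpha2 p : R)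
    (c1 c2 z : C) :
  euler_lagrange_C (lagrangian m1 m2 k1 k2 kappa b alpha1 alpha2 p)
    (fun t : R => (c1 * Cexp (z * RtoC t))%C)
    (fun t : R => (c2 * Cexp (z * RtoC t))%C) <->
  (RtoC m1 * (c1 * z * z)
     = RtoC (b * kappa) * c2 - RtoC ((1 + p * alpha1) * k1) * c1)%C /\
  (RtoC m2 * (c2 * z * z)
     = RtoC (b * kappa) * c1 - RtoC ((1 + p * alpha2) * k2) * c2)%C.
Proof.
unfold euler_lagrange_C.
rewrite (euler_lagrange_newton _ _ _ _ _ _ _ _ _ _ _ _ _ _ _
  (is_derive_Re_Cexp c1 z) (is_derive_Re_Cexp c2 z)
  (is_derive_Re_Cexp (c1 * z) z) (is_derive_Re_Cexp (c2 * z) z)).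
rewrite (euler_lagrange_newton _ _ _ _ _ _ _ _ _ _ _ _ _ _ _
  (is_derive_Im_Cexp c1 z) (is_derive_Im_Cexp c2 z)
  (is_derive_Im_Cexp (c1 * z) z) (is_derive_Im_Cexp (c2 * z) z)).
(* Since the coefficients are real, the two real systems are the real and imaginary parts of a
   single complex system. *)
assert (ReS : forall (r : R) (x : C), r * Re x = Re (RtoC r * x)).
{ intros r [x y]; unfold Re; simpl; ring. }
assert (ImS : forall (r : R) (x : C), r * Im x = Im (RtoC r * x)).
{ intros r [x y]; unfold Im; simpl; ring. }
assert (ReB : forall x y : C, Re x - Re y = Re (x - y)).
{ intros [x x'] [y y']; unfold Re; simpl; ring. }
assert (ImB : forall x y : C, Im x - Im y = Im (x - y)).
{ intros [x x'] [y y']; unfold Im; simpl; ring. }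
split.
- intros [HR HI].
  specialize (HR 0); specialize (HI 0).
  rewrite !ReS, !ReB in HR; rewrite !ImS, !ImB in HI.
  rewrite Cmult_0_r, Cexp_0, !Cmult_1_r in HR, HI.
  destruct HR, HI; split; apply injective_projections; assumption.
- intros [E1 E2].
  assert (F1 : forall e : C, (RtoC m1 * (c1 * z * z * e)
     = RtoC (b * kappa) * (c2 * e) - RtoC ((1 + p * alpha1) * k1) * (c1 * e))%C).
  { intro e; replace (RtoC m1 * (c1 * z * z * e))%C
      with (RtoC m1 * (c1 * z * z) * e)%C by ring; rewrite E1; ring. }
  assert (F2 : forall e : C, (RtoC m2 * (c2 * z * z * e)
     = RtoC (b * kappa) * (c1 * e) - RtoC ((1 + p * alpha2) * k2) * (c2 * e))%C).
  { intro e; replace (RtoC m2 * (c2 * z * z * e))%C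
      with (RtoC m2 * (c2 * z * z) * e)%C by ring; rewrite E2; ring. }
  split; intro t; rewrite ?ReS, ?ReB, ?ImS, ?ImB, F1, F2; now split.
Qed.

(** * Solvability of the linear system for the amplitudes *)

Lemma Csub_eq_0 (u v : C) : (u - v = 0)%C <-> u = v.
Proof.
split; intro H; [replace u with (u - v + v)%C by ring |]; rewrite H; ring.
Qed.

Lemma Copp_eq_0 (u : C) : (- u = 0)%C -> u = 0.
Proof.
intro H; replace u with (- - u)%C by ring; rewrite H; ring.
Qed.

Lemma homogeneous_2x2_nontrivial (x y z w : C) :
  (exists c1 c2 : C, (c1, c2) <> (RtoC 0, RtoC 0) /\
     (x * c1 + y * c2 = 0)%C /\ (z * c1 + w * c2 = 0)%C) <->
  (x * w = y * z)%C.
Proof.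
split.
- intros [c1 [c2 [N [E1 E2]]]]; apply Csub_eq_0.
  (* Cramer's rule: combining the equations with the entries of the adjugate matrix isolates each
     unknown, multiplied by the determinant. *)
  assert (D1 : ((x * w - y * z) * c1 = 0)%C).
  { replace ((x * w - y * z) * c1)%C
      with (w * (x * c1 + y * c2) - y * (z * c1 + w * c2))%C by ring.
    rewrite E1, E2; ring. }
  assert (D2 : ((x * w - y * z) * c2 = 0)%C).
  { replace ((x * w - y * z) * c2)%C
      with (x * (z * c1 + w * c2) - z * (x * c1 + y * c2))%C by ring.
    rewrite E1, E2; ring. }
  destruct (Ceq_dec (x * w - y * z)%C 0) as [Z | NZ]; [exact Z | exfalso].
  apply N; f_equal.
  + destruct (Ceq_dec c1 0) as [H | H]; [exact H |].
    now destruct (Cmult_neq_0 _ _ NZ H).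
  + destruct (Ceq_dec c2 0) as [H | H]; [exact H |].
    now destruct (Cmult_neq_0 _ _ NZ H).
- intros D.
  assert (D' : (x * w - y * z = 0)%C) by (rewrite D; ring).
  (* A nonzero first row [(x, y)] is annihilated by [(y, -x)], and the vanishing determinant handles
     the second row. If the first row is zero, [(w, -z)] serves unless the whole matrix is zero,
     when any nonzero vector does. *)
  destruct (Ceq_dec x 0) as [X | X]; [destruct (Ceq_dec y 0) as [Y | Y] |].
  + destruct (Ceq_dec z 0) as [Z | Z]; [destruct (Ceq_dec w 0) as [W | W] |].
    * exists (RtoC 1), (RtoC 0); split; [| rewrite X, Y, Z, W; split; ring].
      injection; lra.
    * exists w, (- z)%C; split; [| rewrite X, Y; split; ring].
      intros H; apply W; exact (f_equal fst H).
    * exists w, (- z)%C; split; [| rewrite X, Y; split; ring].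
      intros H; apply Z, Copp_eq_0; exact (f_equal snd H).
  + exists y, (- x)%C; split.
    * intros H; apply Y; exact (f_equal fst H).
    * split; [ring |]; rewrite <- (Copp_0), <- D'; ring.
  + exists y, (- x)%C; split.
    * intros H; apply X, Copp_eq_0; exact (f_equal snd H).
    * split; [ring |]; rewrite <- (Copp_0), <- D'; ring.
Qed.

(** The exponent is [Ci * omega], so differentiating twice multiplies an amplitude by minus
    [omega * omega]. The determinant condition is then divided by the nonzero product of the
    masses. *)
Lemma has_eigenmode_det (m1 m2 k1 k2 kappa b alpha1 alpha2 p : R) (omega : C) :
  0 < m1 -> 0 < m2 ->
  has_eigenmode (lagrangian m1 m2 k1 k2 kappa b alpha1 alpha2 p) omega <->
  ((omega * omega - RtoC (Omega_sq m1 k1 alpha1 p)) *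
   (omega * omega - RtoC (Omega_sq m2 k2 alpha2 p)))%C
  = RtoC (b ^ 2 * kappa ^ 2 / (m1 * m2)).
Proof.
intros Hm1 Hm2; unfold has_eigenmode.
set (O1 := Omega_sq m1 k1 alpha1 p); set (O2 := Omega_sq m2 k2 alpha2 p).
assert (K1 : RtoC ((1 + p * alpha1) * k1) = (RtoC m1 * RtoC O1)%C).
{ rewrite <- RtoC_mult; f_equal; unfold O1, Omega_sq; field; lra. }
assert (K2 : RtoC ((1 + p * alpha2) * k2) = (RtoC m2 * RtoC O2)%C).
{ rewrite <- RtoC_mult; f_equal; unfold O2, Omega_sq; field; lra. }
assert (M1 : RtoC m1 <> 0) by (intro H; injection H; lra).
assert (M2 : RtoC m2 <> 0) by (intro H; injection H; lra).
assert (Ci2 : (Ci * Ci = - RtoC 1)%C).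
{ unfold Ci, RtoC; apply injective_projections; simpl; ring. }
set (W := (omega * omega)%C).
transitivity (exists c1 c2 : C, (c1, c2) <> (RtoC 0, RtoC 0) /\
  (RtoC m1 * (W - RtoC O1) * c1 + RtoC (b * kappa) * c2 = 0)%C /\
  (RtoC (b * kappa) * c1 + RtoC m2 * (W - RtoC O2) * c2 = 0)%C).
{ assert (Z2 : forall c : C, (c * (Ci * omega) * (Ci * omega) = - (c * W))%C).
  { intro c; replace (c * (Ci * omega) * (Ci * omega))%C
      with (c * W * (Ci * Ci))%C by (unfold W; ring); rewrite Ci2; ring. }
  split; intros [c1 [c2 [N E]]]; exists c1, c2; split; trivial.
  - apply euler_lagrange_C_Cexp in E.
    (* The pattern matches only the left sides of the equations of motion, so each equation is
       brought to one side exactly once; the rows of the target system are the negatives of the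
       results. *)
    rewrite !Z2, K1, K2, <- !(Csub_eq_0 (_ * - _)%C) in E.
    destruct E as [E1 E2]; split; apply Copp_eq_0.
    + rewrite <- E1; ring.
    + rewrite <- E2; ring.
  - apply euler_lagrange_C_Cexp.
    rewrite !Z2, K1, K2, <- !(Csub_eq_0 (_ * - _)%C).
    destruct E as [E1 E2]; split; apply Copp_eq_0.
    + rewrite <- E1; ring.
    + rewrite <- E2; ring. }
rewrite homogeneous_2x2_nontrivial.
assert (RD : RtoC (b ^ 2 * kappa ^ 2 / (m1 * m2))
  = (RtoC (b * kappa) * RtoC (b * kappa) / (RtoC m1 * RtoC m2))%C).
{ rewrite <- !RtoC_mult, <- RtoC_div; [f_equal; field; lra |].
  now apply Rgt_not_eq, Rmult_lt_0_compat. }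
rewrite RD; split; intro H.
- rewrite <- H; field; now split.
- replace (RtoC (b * kappa) * RtoC (b * kappa))%C with
    (RtoC m1 * RtoC m2 * (RtoC (b * kappa) * RtoC (b * kappa) / (RtoC m1 * RtoC m2)))%C
    by (field; now split).
  rewrite <- H; ring.
Qed.

(** * Roots of the characteristic equation *)

(** The two hypotheses are Vieta's relations: they identify the quadratic with [(z - r) * (z - s)],
    and the complex numbers have no zero divisors. *)
Lemma complex_quadratic_real_roots (A B D r s : R) (z : C) :
  r + s = A + B -> r * s = A * B - D ->
  ((z - RtoC A) * (z - RtoC B) = RtoC D)%C <-> z = RtoC r \/ z = RtoC s.
Proof.
intros HS HP.
assert (S : (RtoC r + RtoC s = RtoC A + RtoC B)%C)
  by (now rewrite <- !RtoC_plus, HS).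
assert (P : (RtoC r * RtoC s = RtoC A * RtoC B - RtoC D)%C)
  by (now rewrite <- !RtoC_mult, <- RtoC_minus, HP).
assert (F : ((z - RtoC A) * (z - RtoC B) - RtoC D
             = (z - RtoC r) * (z - RtoC s))%C).
{ replace ((z - RtoC r) * (z - RtoC s))%C
    with (z * z - (RtoC r + RtoC s) * z + RtoC r * RtoC s)%C by ring.
  rewrite S, P; ring. }
split.
- intro H; rewrite H in F.
  destruct (Ceq_dec (z - RtoC r)%C 0) as [R0 | R0]; [left; now apply Csub_eq_0 |].
  destruct (Ceq_dec (z - RtoC s)%C 0) as [S0 | S0]; [right; now apply Csub_eq_0 |].
  destruct (Cmult_neq_0 _ _ R0 S0); rewrite <- F; ring.
- intros [-> | ->]; apply Csub_eq_0; rewrite F; ring.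
Qed.

(** The radicand is nonnegative, so [sqrt] squares back to it, and the product of the roots is a
    difference of squares. *)
Lemma omega_sq_vieta (m1 m2 k1 k2 kappa alpha1 alpha2 p b : R) :
  0 < m1 -> 0 < m2 ->
  let A := Omega_sq m1 k1 alpha1 p in
  let B := Omega_sq m2 k2 alpha2 p in
  let r := omega_plus_sq m1 m2 k1 k2 kappa alpha1 alpha2 p b in
  let s := omega_minus_sq m1 m2 k1 k2 kappa alpha1 alpha2 p b in
  r + s = A + B /\ r * s = A * B - b ^ 2 * kappa ^ 2 / (m1 * m2).
Proof.
intros Hm1 Hm2 A B r s; unfold r, s, omega_plus_sq, omega_minus_sq; fold A B.
set (D := b ^ 2 * kappa ^ 2 / (m1 * m2)).
assert (0 <= D).
{ apply Rmult_le_pos.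
  - rewrite <- Rpow_mult_distr; apply pow2_ge_0.
  - now apply Rlt_le, Rinv_0_lt_compat, Rmult_lt_0_compat. }
assert (0 <= (A - B) ^ 2 / 4 + D) by (pose proof (pow2_ge_0 (A - B)); lra).
pose proof (sqrt_sqrt _ H0) as Q.
split; [field |].
set (q := sqrt _) in *.
replace (((A + B) / 2 + q) * ((A + B) / 2 - q))
  with ((A + B) ^ 2 / 4 - q * q) by field.
rewrite Q; field.
Qed.

(** * Frequency splitting at the crossing *)

Lemma sqrt_coupling (m1 m2 kappa b : R) :
  0 < m1 -> 0 < m2 -> 0 <= kappa -> 0 <= b ->
  sqrt (b ^ 2 * kappa ^ 2 / (m1 * m2)) = b * kappa / sqrt (m1 * m2).
Proof.
intros Hm1 Hm2 Hk Hb.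
assert (Hm : 0 < m1 * m2) by now apply Rmult_lt_0_compat.
rewrite <- Rpow_mult_distr, sqrt_div_alt, sqrt_pow2; trivial.
now apply Rmult_le_pos.
Qed.

(** Both squared partial frequencies are affine in [q], with intercepts [k1 / m1], [k2 / m2] and
    slopes [s1], [s2]; lines of distinct slopes meet exactly once. *)
Lemma Omega_sq_crossing (m1 m2 k1 k2 alpha1 alpha2 q : R) :
  alpha1 * k1 / m1 <> alpha2 * k2 / m2 ->
  Omega_sq m1 k1 alpha1 q = Omega_sq m2 k2 alpha2 q <->
  q = p_star m1 m2 k1 k2 alpha1 alpha2.
Proof.
intros N; unfold Omega_sq, p_star.
set (s1 := alpha1 * k1 / m1) in *; set (s2 := alpha2 * k2 / m2) in *.
replace ((1 + q * alpha1) * k1 / m1) with (k1 / m1 + q * s1)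
  by (unfold s1, Rdiv; ring).
replace ((1 + q * alpha2) * k2 / m2) with (k2 / m2 + q * s2)
  by (unfold s2, Rdiv; ring).
assert (NZ : s1 - s2 <> 0) by lra.
split; intro H.
- replace (k2 / m2 - k1 / m1) with (q * (s1 - s2)) by lra; now field.
- assert (q * (s1 - s2) = k2 / m2 - k1 / m1)
    by (rewrite H; unfold Rdiv; rewrite Rmult_assoc, Rinv_l, Rmult_1_r; trivial).
  lra.
Qed.

Theorem mainTheorem4 :
  forall (m1 m2 k1 k2 kappa alpha1 alpha2 : R),
  0 < m1 -> 0 < m2 -> 0 < k1 -> 0 < k2 -> 0 < kappa ->
  (forall (b p : R), 0 <= b -> Rabs p <= 1 / 5 ->
   forall omega : C,
   (has_eigenmode (lagrangian m1 m2 k1 k2 kappa b alpha1 alpha2 p) omega <->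
      ((omega * omega - RtoC (Omega_sq m1 k1 alpha1 p)) *
       (omega * omega - RtoC (Omega_sq m2 k2 alpha2 p)))%C
      = RtoC (b ^ 2 * kappa ^ 2 / (m1 * m2))) /\
   (has_eigenmode (lagrangian m1 m2 k1 k2 kappa b alpha1 alpha2 p) omega <->
      (omega * omega)%C
        = RtoC (omega_plus_sq m1 m2 k1 k2 kappa alpha1 alpha2 p b) \/
      (omega * omega)%C
        = RtoC (omega_minus_sq m1 m2 k1 k2 kappa alpha1 alpha2 p b))) /\
  (alpha1 * k1 / m1 <> alpha2 * k2 / m2 ->
   let ps := p_star m1 m2 k1 k2 alpha1 alpha2 in
   (forall q : R, Omega_sq m1 k1 alpha1 q = Omega_sq m2 k2 alpha2 q <-> q = ps) /\
   (Rabs ps <= 1 / 5 ->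
    forall b : R, 0 <= b ->
    let Os := Omega_sq m1 k1 alpha1 ps in
    Os = Omega_sq m2 k2 alpha2 ps /\
    omega_plus_sq m1 m2 k1 k2 kappa alpha1 alpha2 ps b
      = Os + b * kappa / sqrt (m1 * m2) /\
    omega_minus_sq m1 m2 k1 k2 kappa alpha1 alpha2 ps b
      = Os - b * kappa / sqrt (m1 * m2) /\
    (0 < b ->
       omega_plus_sq m1 m2 k1 k2 kappa alpha1 alpha2 ps b <> Os /\
       omega_minus_sq m1 m2 k1 k2 kappa alpha1 alpha2 ps b <> Os))).
Proof.
intros m1 m2 k1 k2 kappa alpha1 alpha2 Hm1 Hm2 Hk1 Hk2 Hk; split.
- intros b p Hb Hp omega.
  destruct (omega_sq_vieta m1 m2 k1 k2 kappa alpha1 alpha2 p b Hm1 Hm2) as [S P].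
  (* The first equivalence becomes a tautology, and the second a quadratic equation in the unknown
     [omega * omega]. *)
  rewrite (has_eigenmode_det _ _ _ _ _ _ _ _ _ _ Hm1 Hm2).
  split; [reflexivity |].
  now apply complex_quadratic_real_roots.
- intros N ps; split; [intro q; now apply Omega_sq_crossing |].
  intros _ b Hb Os.
  assert (E : Os = Omega_sq m2 k2 alpha2 ps) by now apply Omega_sq_crossing.
  (* At the crossing the detuning vanishes and the radicand reduces to the coupling term. *)
  assert (Q : sqrt ((Os - Os) ^ 2 / 4 + b ^ 2 * kappa ^ 2 / (m1 * m2))
              = b * kappa / sqrt (m1 * m2)).
  { rewrite <- sqrt_coupling; try lra; f_equal; field; lra. }
  assert (Ep : omega_plus_sq m1 m2 k1 k2 kappa alpha1 alpha2 ps b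
               = Os + b * kappa / sqrt (m1 * m2)).
  { unfold omega_plus_sq; rewrite <- E; fold Os; rewrite Q; lra. }
  assert (Em : omega_minus_sq m1 m2 k1 k2 kappa alpha1 alpha2 ps b
               = Os - b * kappa / sqrt (m1 * m2)).
  { unfold omega_minus_sq; rewrite <- E; fold Os; rewrite Q; lra. }
  repeat split; trivial; rewrite ?Ep, ?Em.
  (* For [b > 0] the shift away from [Os] is strictly positive, which separates both branches from
     it. *)
  all: assert (0 < b * kappa / sqrt (m1 * m2))
    by (apply Rdiv_lt_0_compat; [| apply sqrt_lt_R0]; now apply Rmult_lt_0_compat).
  all: lra.
Qed.
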